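(* Let $(f_d)_{d\ge 0}$ be the Fibonacci-type sequence defined by $f_0=1$, $f_1=1$ and $f_d=f_{d-1}+f_{d-2}$ for $d\ge 2$, and set $f_{-1}=0$. Call an integer partition a basal billiard partition if its parts are distinct, its smallest part equals $2$, no two adjacent parts (in the ordering by size) are both odd, and the difference between any two adjacent parts is at most $2$. Then for every integer $d\ge 1$: (a) there are exactly $f_d$ basal billiard partitions with $d$ parts; (b) there are exactly $f_{d-1}$ basal billiard partitions with $d$ parts whose largest part is even; (c) there are exactly $f_{d-2}$ basal billiard partitions with $d$ parts whose largest part is odd.
   Context: Partitions are written as $m_1<m_2<\dots<m_d$ (distinct positive parts); ''adjacent parts'' means $m_i,m_{i+1}$ for some $i$. *)

(* Defs.v *)
From mathcomp Require Import all_boot all_order all_algebra.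

Set Implicit Arguments.
Unset Strict Implicit.
Unset Printing Implicit Defensive.

Import GRing.Theory Num.Theory.

(* The sequence f_0 = f_1 = 1, f_d = f_(d-1) + f_(d-2). *)
Fixpoint fib_nat (n : nat) : nat :=
  match n with
  | 0 => 1
  | n'.+1 => match n' with
             | 0 => 1
             | n''.+1 => fib_nat n' + fib_nat n''
             end
  end.

(* Integer indices make f_(-1) = 0 available; the value at indices below -1
   is a dummy. *)
Definition fib (z : int) : nat :=
  match z with
  | Posz n => fib_nat n
  | Negz _ => 0
  end.

(* An integer partition is the sequence of its positive parts, repetitions
   allowed, in weakly increasing order. *)
Definition is_partition (p : seq nat) : bool := sorted leq p && (0 \notin p).

Definition smallest_part (p : seq nat) : nat := head 0 p.

Definition largest_part (p : seq nat) : nat := last 0 p.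

(* [sorted r p] says that r holds between any two adjacent parts. *)
Definition basal_billiard (p : seq nat) : bool :=
  [&& is_partition p, uniq p, smallest_part p == 2,
      sorted (fun m n => ~~ (odd m && odd n)) p
    & sorted (fun m n => n - m <= 2) p].

(* Main.v *)
Require Import Defs.
From mathcomp Require Import all_boot all_order all_algebra.
From mathcomp Require Import classical_sets cardinality.
From mathcomp Require Import finmap zify.

Set Implicit Arguments.
Unset Strict Implicit.
Unset Printing Implicit Defensive.

Local Open Scope classical_set_scope.
Local Open Scope card_scope.

(** Strictly increasing parts with gaps at most 2 and no adjacent odd pair means that a part [m] is
    followed by [m + 1], or by [m + 2] when [m] is even ([basal_billiardE], [billiard_stepE]). Hence
    deleting the last part sends an odd-ended partition to an even-ended one, while an even-ended
    one comes from either parity, in exactly one way each. The even and odd counts thus satisfy e' =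
    e + o and o' = e, starting from 1 and 0 at the single partition [[:: 2]], which is the Fibonacci
    recursion. The explicit enumeration [billiards] realises this: it is complete ([mem_billiards]),
    free of repetitions ([billiards_uniq]) and of the right length ([size_billiards]). *)

Lemma card_eq_size (T : choiceType) (A : set T) (s : seq T) :
  uniq s -> (forall x, A x <-> x \in s) -> A #= `I_(size s).
Proof.
move=> s_uniq As; have -> : A = [set` [fset x in s]%fset].
  by apply/seteqP; split=> x /=; rewrite inE; apply As.
by apply/card_eq_fsetP; rewrite card_fseq undup_id.
Qed.

Definition billiard_step : rel nat :=
  fun m n => [&& m < n, n - m <= 2 & ~~ (odd m && odd n)].

Lemma billiard_stepE m n :
  billiard_step m n = (n == m.+1) || (n == m.+2) && ~~ odd m.
Proof. rewrite /billiard_step; lia. Qed.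

Lemma basal_billiardE p :
  basal_billiard p = (head 0 p == 2) && sorted billiard_step p.
Proof.
case: p => // x s; rewrite /basal_billiard /is_partition /=.
have stepE y t : path billiard_step y t =
    [&& path ltn y t, path (fun m n => ~~ (odd m && odd n)) y t
      & path (fun m n => n - m <= 2) y t].
  elim: t y => //= z t IH y; rewrite IH /billiard_step.
  by case: (y < z); case: (z - y <= 2); case: (odd y && odd z); rewrite ?andbF.
have ltnE : path ltn x s = uniq (x :: s) && path leq x s
  := ltn_sorted_uniq_leq (x :: s).
case: (x =P 2) => [x2|_]; last by rewrite !andbF.
rewrite stepE ltnE x2 /= inE /=.
case le2s: (path leq 2 s); rewrite /= ?andbF //.
(* All later parts are at least the head 2, so none is 0. *)
suff -> : 0 \notin s by rewrite andbT.
by apply/negP => /(allP (order_path_min leq_trans le2s)).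
Qed.

Definition extend k (p : seq nat) := rcons p (largest_part p + k).

Lemma extend_inj k : injective (extend k).
Proof. by move=> p q /rcons_inj[]. Qed.

Lemma mem_map_extend k x q s :
  (rcons q x \in map (extend k) s) = (q \in s) && (x == largest_part q + k).
Proof.
apply/mapP/andP => [[r rs /rcons_inj[-> ->]] // | [qs /eqP->]].
by exists q.
Qed.

Lemma nil_map_extend k s : ([::] \in map (extend k) s) = false.
Proof. by apply/mapP => -[[|x p]]. Qed.

(* The basal billiard partitions with [n.+1] parts whose largest part has
   parity [b]: a part [m] can be followed by [m + 1], or by [m + 2] if [m] is
   even. *)
Fixpoint billiards (n : nat) (b : bool) : seq (seq nat) :=
  if n is n'.+1 then
    map (extend 1) (billiards n' (~~ b))
      ++ (if b then [::] else map (extend 2) (billiards n' b))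
  else if b then [::] else [:: [:: 2]].

(** Induction on [n], splitting off the last part: adding 1 flips its parity, adding 2 keeps it and
    is allowed only from an even part. *)
Lemma mem_billiards n b p : (p \in billiards n b) =
  [&& basal_billiard p, size p == n.+1 & odd (largest_part p) == b].
Proof.
elim: n b p => [|n IH] b p.
  rewrite basal_billiardE /largest_part.
  by case: p b => [|x [|y s]] [] //=; rewrite ?inE ?andbF // ?andbT ?eqseq_cons;
    case: x => [|[|[|x]]].
case/lastP: p => [|q x]; first by
  rewrite basal_billiardE /= mem_cat nil_map_extend; case: b; rewrite ?nil_map_extend.
have -> : (rcons q x \in billiards n.+1 b) =
    (q \in billiards n (~~ b)) && (x == largest_part q + 1)
      || ~~ b && (q \in billiards n b) && (x == largest_part q + 2).
  by rewrite /= mem_cat mem_map_extend; case: b; rewrite // mem_map_extend.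
rewrite !IH !basal_billiardE size_rcons eqSS /largest_part last_rcons.
case: q => [|y q]; first by rewrite !andbF.
rewrite /= rcons_path billiard_stepE addn1 addn2.
case: (y == 2); case: (path _ y q); rewrite ?andbF //=.
case: (_ == n.+1); rewrite ?andbF //= ?andbT.
by case: b; rewrite ?eqb_id ?eqbF_neg /=; lia.
Qed.

Lemma billiards_uniq n b : uniq (billiards n b).
Proof.
elim: n b => [|n IH] b; first by case: b.
rewrite /= cat_uniq (map_inj_uniq (@extend_inj 1)) IH /=.
case: b => //=; rewrite (map_inj_uniq (@extend_inj 2)) IH andbT.
(* The two families are disjoint: a common member would have one prefix whose largest part is raised
   both by 1 and by 2. *)
apply/hasPn => _ /mapP[p + ->]; apply: contraL.
by rewrite mem_map_extend eqn_add2l andbF.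
Qed.

(** The odd count lags one index behind the even count. The integer index covers [n = 0],
    [b = true], where the empty list matches the value 0 at index -1. *)
Lemma size_billiards n b : size (billiards n b) = fib (n%:Z - b%:Z)%R.
Proof.
suff [e o] : size (billiards n false) = fib n /\
    size (billiards n true) = fib (n%:Z - 1)%R.
  by case: b; rewrite ?GRing.subr0.
elim: n => // n [IHe IHo] /=.
rewrite !size_cat !size_map IHe IHo addn0.
split; last by rewrite subn1.
(* At [n = 0] the recursion reads f_1 = f_(-1) + f_0 and holds by computation. *)
case: n {IHe IHo} => // n.
have -> : (n.+1%:Z - 1)%R = n by lia.
by rewrite addnC.
Qed.

Theorem theorem3p1 (d : nat) (hd : 1 <= d) :
  [/\ [set p : seq nat | basal_billiard p /\ size p = d]
        #= `I_(fib d%:Z),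
      [set p : seq nat | [/\ basal_billiard p, size p = d
                           & ~~ odd (largest_part p)]]
        #= `I_(fib (d%:Z - 1)%R)
    & [set p : seq nat | [/\ basal_billiard p, size p = d
                           & odd (largest_part p)]]
        #= `I_(fib (d%:Z - 2)%R)].
Proof.
case: d hd => // n _.
(* Here d = [n.+1], and [billiards n] lists the partitions with [n.+1] parts. *)
have -> : (n.+1%:Z - 1 = n%:Z - false%:Z)%R by lia.
have -> : (n.+1%:Z - 2 = n%:Z - true%:Z)%R by lia.
rewrite -!size_billiards; split.
- have -> : fib n.+1 = size (billiards n true ++ billiards n false).
    (* Every partition with [n.+1] parts, of either parity, has exactly one even-ended extension, so
       the total is the even count one level up. *)
    have := size_billiards n.+1 false; rewrite GRing.subr0 => <-.
    by rewrite /= !size_cat !size_map.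
  apply: card_eq_size => [|p].
    rewrite cat_uniq !billiards_uniq andbT /=.
    apply/hasPn => p; rewrite !mem_billiards.
    by case/and3P=> _ _ /eqP->; rewrite !andbF.
  rewrite mem_cat !mem_billiards /=.
  by case: basal_billiard; case: eqP; case: odd; split=> // -[].
- apply: card_eq_size (billiards_uniq _ _) _ => p /=.
  rewrite mem_billiards eqbF_neg.
  by split=> [[-> -> ->]|/and3P[-> /eqP-> ->]]; rewrite ?eqxx.
- apply: card_eq_size (billiards_uniq _ _) _ => p /=.
  rewrite mem_billiards eqb_id.
  by split=> [[-> -> ->]|/and3P[-> /eqP-> ->]]; rewrite ?eqxx.
Qed.
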